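(* Let $H$ be a finite dimensional complex Hilbert space, let $\phi\in P(H)$, and let $\mathcal{C}$ be a symmetric mapping cone in $P(H)$. Then the following conditions are equivalent. (i) $\phi\in\mathcal{C}^{o}$, the dual cone of $\mathcal{C}$. (ii) $\phi\circ\psi$ is completely positive for all $\psi\in\mathcal{C}$. (iii) $\psi\otimes\phi\colon B(H\otimes H)\to B(H\otimes H)$ is positive for all $\psi\in\mathcal{C}$. (iv) $(\psi\otimes\phi)(p)\geq 0$ for all $\psi\in\mathcal{C}$, where $p=\sum_{i,j} e_{ij}\otimes e_{ij}$.
   Context: $B(H)$ denotes the linear operators on $H$, with $n=\dim H<\infty$; $Tr$ is the usual trace. Fix an orthonormal basis $e_1,\dots,e_n$ of $H$ with matrix units $e_{ij}\in B(H)$, $e_{ij}e_k=\delta_{jk}e_i$; $t$ (also $b\mapsto b^t$) is the transpose map on $B(H)$ with respect to this basis. $B(H\otimes H)$ is identified with $B(H)\otimes B(H)$, and $p=\sum_{i,j=1}^n e_{ij}\otimes e_{ij}$. A linear map is positive if it sends positive semidefinite operators to positive semidefinite operators. $P(H)$ is the cone of positive linear maps $B(H)\to B(H)$, and $CP(H)\subset P(H)$ is the set of completely positive ones. For a linear map $\phi\colon B(H)\to B(H)$, its adjoint $\phi^*$ is defined by $Tr(\phi(a)b)=Tr(a\phi^*(b))$ for $a,b\in B(H)$, and $\phi^t=t\circ\phi\circ t$. The Choi matrix of $\phi$ is $C_\phi=\sum_{i,j}e_{ij}\otimes\phi(e_{ij})=(\iota\otimes\phi)(p)$, where $\iota$ is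 the identity map. A mapping cone is a closed subcone $\mathcal{C}$ of $P(H)$ such that if $\phi\in\mathcal{C}$ and $\alpha,\beta\in CP(H)$ then $\alpha\circ\phi\in\mathcal{C}$ and $\phi\circ\beta\in\mathcal{C}$. It is symmetric if $\phi\in\mathcal{C}\iff\phi^*\in\mathcal{C}\iff\phi^t\in\mathcal{C}$. The dual cone of $\mathcal{C}$ is $\mathcal{C}^{o}=\{\phi\in P(H): Tr(C_\phi C_\psi)\geq 0\ \text{for all }\psi\in\mathcal{C}\}$. *)

(* Defs.v *)
From HB Require Import structures.
From mathcomp Require Import all_boot all_order all_algebra.
From mathcomp Require Import spectral mxtens.
From mathcomp Require Import classical_sets topology.
Import Order.TTheory GRing.Theory Num.Theory.
Import numFieldTopology.Exports.

Set Implicit Arguments.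
Unset Strict Implicit.
Unset Printing Implicit Defensive.

Local Open Scope classical_set_scope.
Local Open Scope ring_scope.
Local Open Scope sesquilinear_scope.

(* The Hilbert space H, with its fixed orthonormal basis, is C^n, so that B(H)
   is 'M[C]_n, e_ij is delta_mx i j, and the transpose t is trmx.  Linear maps
   B(H) -> B(H) are elements of 'End('M[C]_n).  B(K (x) H) is 'M[C]_(m * n),
   with a (x) b the Kronecker product a *t b and the basis of K (x) H indexed
   through mxtens_index.  The algebraic definitions are stated for any
   numClosedFieldType C; C = R[i] with R : realType gives the complex numbers. *)

(* In a numClosedFieldType, 0 <= z means that z is real and nonnegative, so
   this condition also forces A to be Hermitian. *)
Definition psdmx (C : numClosedFieldType) (n : nat) (A : 'M[C]_n) : Prop :=
  forall v : 'cV[C]_n, 0 <= (v ^t* *m A *m v) 0 0.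

Definition positive_map (C : numClosedFieldType) (m n : nat)
    (f : 'M[C]_m -> 'M[C]_n) : Prop :=
  forall A, psdmx A -> psdmx (f A).

(* psi (x) phi, i.e. the linear map such that a (x) b |-> psi a (x) phi b (see
   tensmap_tens and tensmap_unique), evaluated at
   X = sum X_((i,k),(j,l)) e_ij (x) e_kl. *)
Definition tensmap (C : numClosedFieldType) (m n : nat)
    (psi : 'End('M[C]_m)) (phi : 'End('M[C]_n)) (X : 'M[C]_(m * n)) :
    'M[C]_(m * n) :=
  \sum_(i < m) \sum_(j < m) \sum_(k < n) \sum_(l < n)
    X (mxtens_index (i, k)) (mxtens_index (j, l)) *:
      (psi (delta_mx i j) *t phi (delta_mx k l)).

Definition completely_positive (C : numClosedFieldType) (n : nat)
    (phi : 'End('M[C]_n)) : Prop :=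
  forall k : nat, positive_map (tensmap (\1 : 'End('M[C]_k))%VF phi).

Definition pmx (C : numClosedFieldType) (n : nat) : 'M[C]_(n * n) :=
  \sum_(i < n) \sum_(j < n) delta_mx i j *t delta_mx i j.

Definition choi (C : numClosedFieldType) (n : nat) (phi : 'End('M[C]_n)) :
    'M[C]_(n * n) :=
  \sum_(i < n) \sum_(j < n) delta_mx i j *t phi (delta_mx i j).

(* The adjoint for the bilinear pairing (a, b) |-> Tr (a b); its (i, j) entry is
   read off Tr (phi a *m b) = Tr (a *m adjmap phi b) at a = e_ji (see adjmapP
   and adjmap_unique). *)
Definition adjmap_fun (C : numClosedFieldType) (n : nat) (phi : 'End('M[C]_n))
    (b : 'M[C]_n) : 'M[C]_n :=
  \matrix_(i, j) \tr (phi (delta_mx j i) *m b).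

Fact adjmap_is_linear (C : numClosedFieldType) (n : nat)
  (phi : 'End('M[C]_n)) : linear (adjmap_fun phi).
Proof.
move=> a u v; apply/matrixP => i j.
by rewrite !mxE mulmxDr -scalemxAr mxtraceD mxtraceZ.
Qed.

HB.instance Definition _ (C : numClosedFieldType) (n : nat)
    (phi : 'End('M[C]_n)) :=
  GRing.isLinear.Build C 'M[C]_n 'M[C]_n _ (adjmap_fun phi)
    (adjmap_is_linear phi).

Definition adjmap (C : numClosedFieldType) (n : nat) (phi : 'End('M[C]_n)) :
    'End('M[C]_n) :=
  linfun (adjmap_fun phi).

Definition trmap (C : numClosedFieldType) (n : nat) (phi : 'End('M[C]_n)) :
    'End('M[C]_n) :=
  (linfun trmx \o phi \o linfun trmx)%VF.

(* Closedness refers to the usual topology of a finite dimensional space, via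
   the matrices lin_mx phi of the linear maps phi. *)
Record mapping_cone (C : numClosedFieldType) (n : nat)
    (K : set 'End('M[C]_n)) : Prop := MappingCone {
  mcone_pos : forall phi, K phi -> positive_map phi;
  mcone0 : K 0;
  mconeD : forall phi psi, K phi -> K psi -> K (phi + psi);
  mconeZ : forall (a : C) phi, 0 <= a -> K phi -> K (a *: phi);
  mcone_closed : closed [set lin_mx phi | phi in K];
  mcone_compl : forall alpha phi,
    completely_positive alpha -> K phi -> K (alpha \o phi)%VF;
  mcone_compr : forall phi beta,
    K phi -> completely_positive beta -> K (phi \o beta)%VF
}.

Definition symmetric_cone (C : numClosedFieldType) (n : nat)
    (K : set 'End('M[C]_n)) : Prop :=
  forall phi, (K phi <-> K (adjmap phi)) /\ (K (adjmap phi) <-> K (trmap phi)).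

Definition dual_cone (C : numClosedFieldType) (n : nat)
    (K : set 'End('M[C]_n)) : set 'End('M[C]_n) :=
  [set phi : 'End('M[C]_n) | positive_map phi /\
             forall psi, K psi -> 0 <= \tr (choi phi *m choi psi)].

Lemma tensmap_is_linear (C : numClosedFieldType) (m n : nat)
  (psi : 'End('M[C]_m)) (phi : 'End('M[C]_n)) : linear (tensmap psi phi).
Proof.
move=> a u v; rewrite /tensmap scaler_sumr -big_split; apply: eq_bigr => i _ /=.
rewrite scaler_sumr -big_split; apply: eq_bigr => j _ /=.
rewrite scaler_sumr -big_split; apply: eq_bigr => k _ /=.
rewrite scaler_sumr -big_split; apply: eq_bigr => l _ /=.
by rewrite !mxE scalerDl scalerA.
Qed.

HB.instance Definition _ (C : numClosedFieldType) (m n : nat)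
    (psi : 'End('M[C]_m)) (phi : 'End('M[C]_n)) :=
  GRing.isLinear.Build C 'M[C]_(m * n) 'M[C]_(m * n) _ (tensmap psi phi)
    (tensmap_is_linear psi phi).

Lemma tensmap_tens (C : numClosedFieldType) (m n : nat)
  (psi : 'End('M[C]_m)) (phi : 'End('M[C]_n)) (a : 'M[C]_m) (b : 'M[C]_n) :
  tensmap psi phi (a *t b) = psi a *t phi b.
Proof.
rewrite {2}(matrix_sum_delta a) {2}(matrix_sum_delta b) !linear_sum /=.
apply/matrixP => x y; case: (mxtens_indexP x) => x1 x2.
case: (mxtens_indexP y) => y1 y2.
rewrite tensmxE /tensmap !summxE big_distrl /=; apply: eq_bigr => i _.
rewrite !linear_sum !summxE big_distrl /=; apply: eq_bigr => j _.
rewrite big_distrr /=; rewrite summxE; apply: eq_bigr => k _.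
rewrite linear_sum !summxE big_distrr /=; apply: eq_bigr => l _.
by rewrite tensmxE !linearZ !mxE !mxtens_indexK /= mulrACA.
Qed.

Lemma tensmap_unique (C : numClosedFieldType) (m n : nat)
  (psi : 'End('M[C]_m)) (phi : 'End('M[C]_n)) (F : 'End('M[C]_(m * n))) :
  (forall a b, F (a *t b) = psi a *t phi b) -> F =1 tensmap psi phi.
Proof.
move=> FE X; rewrite /tensmap.
transitivity (F (tensmap \1%VF \1%VF X)); last first.
  rewrite linear_sum; apply: eq_bigr => i _; rewrite linear_sum.
  apply: eq_bigr => j _; rewrite linear_sum; apply: eq_bigr => k _.
  rewrite linear_sum; apply: eq_bigr => l _.
  by rewrite linearZ /= !id_lfunE FE.
congr (F _); apply/matrixP => x y; case: (mxtens_indexP x) => x1 x2.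
case: (mxtens_indexP y) => y1 y2; rewrite summxE (bigD1 x1) //= summxE.
rewrite (bigD1 y1) //= summxE (bigD1 x2) //= summxE (bigD1 y2) //=.
have D (i j : 'I_m) (k l : 'I_n) :
    (X (mxtens_index (i, k)) (mxtens_index (j, l)) *:
      ((\1%VF : 'End('M[C]_m)) (delta_mx i j) *t
       (\1%VF : 'End('M[C]_n)) (delta_mx k l)))
      (mxtens_index (x1, x2)) (mxtens_index (y1, y2)) =
    X (mxtens_index (i, k)) (mxtens_index (j, l)) *
      (((x1 == i) && (y1 == j))%:R * ((x2 == k) && (y2 == l))%:R).
  by rewrite mxE tensmxE !id_lfunE !mxE.
rewrite D !eqxx !mulr1 big1 ?addr0 => [|l nl]; last first.
  by rewrite D (eq_sym y2) (negbTE nl) andbF !mulr0.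
rewrite big1 ?addr0 => [|k nk]; last first.
  by rewrite summxE big1 // => l _; rewrite D (eq_sym x2) (negbTE nk) !mulr0.
rewrite big1 ?addr0 => [|j nj]; last first.
  rewrite summxE big1 // => k _; rewrite summxE big1 // => l _.
  by rewrite D (eq_sym y1) (negbTE nj) andbF mul0r mulr0.
rewrite big1 ?addr0 // => i ni.
rewrite summxE big1 // => j _; rewrite summxE big1 // => k _.
rewrite summxE big1 // => l _.
by rewrite D (eq_sym x1) (negbTE ni) mul0r mulr0.
Qed.

Lemma choiE (C : numClosedFieldType) (n : nat) (phi : 'End('M[C]_n)) :
  choi phi = tensmap (\1 : 'End('M[C]_n))%VF phi (pmx C n).
Proof.
rewrite /pmx linear_sum; apply: eq_bigr => i _; rewrite linear_sum.
by apply: eq_bigr => j _; rewrite [RHS]tensmap_tens id_lfunE.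
Qed.

Lemma adjmapP (C : numClosedFieldType) (n : nat) (phi : 'End('M[C]_n))
  (a b : 'M[C]_n) : \tr (phi a *m b) = \tr (a *m adjmap phi b).
Proof.
rewrite lfunE /= {1}(matrix_sum_delta a) linear_sum /= mulmx_suml linear_sum /=.
apply: eq_bigr => i _; rewrite mxE linear_sum /= mulmx_suml linear_sum /=.
by apply: eq_bigr => j _; rewrite linearZ /= -scalemxAl mxtraceZ mxE.
Qed.

Lemma adjmap_unique (C : numClosedFieldType) (n : nat)
  (phi phi' : 'End('M[C]_n)) :
  (forall a b, \tr (phi a *m b) = \tr (a *m phi' b)) -> phi' = adjmap phi.
Proof.
move=> H; apply/lfunP => b; rewrite lfunE /=; apply/matrixP => i j.
rewrite mxE H /mxtrace (bigD1 j) //= mxE (bigD1 i) //= mxE !eqxx mul1r.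
rewrite big1 ?addr0 => [|k nk]; last by rewrite mxE (negbTE nk) andbF mul0r.
rewrite big1 ?addr0 // => k nk; rewrite mxE big1 // => l _.
by rewrite mxE (negbTE nk) mul0r.
Qed.

Lemma trmapE (C : numClosedFieldType) (n : nat) (phi : 'End('M[C]_n))
  (a : 'M[C]_n) : trmap phi a = (phi a^T)^T.
Proof. by rewrite !comp_lfunE !lfunE. Qed.

(* Main.v *)
(* Write Omega = sum_i e_i (x) e_i, so that p = Omega Omega^*, and Ad_M a = M a M^*.
   A linear map is positive as soon as it is positive on rank-one operators v v^*,
   and vectors of H (x) H are coded by matrices V, W.  Then
   <w, (psi (x) phi)(v v^* ) w> = Tr (C_phi C_chi) for a map chi obtained from the
   transposed map psi^t by composing with Ad's on both sides, hence chi lies in the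
   cone with psi.  Since moreover Tr (C_(phi psi) C_chi) = Tr (C_phi C_(chi psi^* )),
   every condition amounts to Tr (C_phi C_chi) >= 0 on the cone. *)
Require Import Defs.
From HB Require Import structures.
From mathcomp Require Import all_boot all_order all_algebra.
From mathcomp Require Import complex spectral mxtens ring.
From mathcomp Require Import classical_sets reals.

Set Implicit Arguments.
Unset Strict Implicit.
Unset Printing Implicit Defensive.

Import Order.TTheory GRing.Theory Num.Theory.

Local Open Scope ring_scope.
Local Open Scope sesquilinear_scope.

(** * Sums and traces over tensor product indices *)

Lemma sum_mxtens_index (V : nmodType) (m n : nat) (F : 'I_(m * n) -> V) :
  \sum_x F x = \sum_(i < m) \sum_(k < n) F (mxtens_index (i, k)).
Proof.
rewrite pair_bigA (reindex (@mxtens_index m n)); first by apply: eq_bigr => -[].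
by exists (@mxtens_unindex m n) => x _; rewrite ?mxtens_indexK ?mxtens_unindexK.
Qed.

Lemma mxtrace_delta (R : comPzRingType) (n : nat) (i j : 'I_n) :
  \tr (delta_mx i j : 'M[R]_n) = (i == j)%:R.
Proof.
rewrite -(mul_delta_mx (0 : 'I_1)) mxtrace_mulC mul_delta_mx_cond trace_mx11.
by rewrite mulmxnE !mxE eq_sym.
Qed.

Lemma mxtrace_tens (R : comPzRingType) (m n : nat) (A : 'M[R]_m) (B : 'M[R]_n) :
  \tr (A *t B) = \tr A * \tr B.
Proof.
rewrite /mxtrace sum_mxtens_index mulr_suml; apply: eq_bigr => i _.
by rewrite mulr_sumr; apply: eq_bigr => k _; rewrite tensmxE.
Qed.

(** * Spectral decompositions and positivity on rank-one operators *)

Section Positivity.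
Variable C : numClosedFieldType.

Lemma adjmx_mul (m n p : nat) (A : 'M[C]_(m, n)) (B : 'M[C]_(n, p)) :
  (A *m B)^t* = B^t* *m A^t*.
Proof. by rewrite trmx_mul map_mxM. Qed.

(** The [u k] are the orthonormal eigenvectors given by the spectral theorem. Each eigenvalue is
    written as a value of the quadratic form of [A], so that the sign or vanishing of that form
    passes directly to the coefficients. *)
Lemma normalmx_rank1_sum (n : nat) (A : 'M[C]_n) : A \is normalmx ->
  exists u : 'I_n -> 'cV[C]_n,
    A = \sum_k ((u k)^t* *m A *m u k) 0 0 *: (u k *m (u k)^t*).
Proof.
move=> /orthomx_spectralP; set P := spectralmx A; set d := spectral_diag A => AE.
have PU : P \is unitarymx := spectral_unitarymx A.
rewrite (invmx_unitary PU) in AE.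
pose e k : 'cV[C]_n := delta_mx k 0.
have qE k : ((P^t* *m e k)^t* *m A *m (P^t* *m e k)) 0 0 = d 0 k.
  have -> : (P^t* *m e k)^t* *m A *m (P^t* *m e k) =
      (e k)^t* *m (P *m P^t*) *m diag_mx d *m (P *m P^t*) *m e k.
    by rewrite [in LHS]AE adjmx_mul trmxCK !mulmxA.
  rewrite (unitarymxP PU) !mulmx1 trmx_delta map_delta_mx.
  by rewrite -rowE -colE !mxE eqxx mulr1n.
exists (fun k => P^t* *m e k).
under eq_bigr => k _ do rewrite qE adjmx_mul trmxCK !mulmxA.
rewrite {1}AE diag_mx_sum_delta mulmx_sumr mulmx_suml.
apply: eq_bigr => k _; rewrite -scalemxAr -scalemxAl.
by rewrite trmx_delta map_delta_mx -(mulmxA _ (delta_mx k 0)) mul_delta_mx.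
Qed.

(* The defect A - A^* is normal and its quadratic form vanishes, so its
   spectral decomposition is 0. *)
Lemma psdmx_hermitian (n : nat) (A : 'M[C]_n) : psdmx A -> A^t* = A.
Proof.
move=> Apsd; pose B := A - A^t*.
have BE : B^t* = - B by rewrite /B linearB /= map_mxB trmxCK opprB.
have B_normal : B \is normalmx by apply/normalmxP; rewrite BE mulmxN mulNmx.
have B0 (v : 'cV[C]_n) : (v^t* *m B *m v) 0 0 = 0.
  rewrite mulmxBr mulmxBl mxE [X in _ + X]mxE.
  have -> : v^t* *m A^t* *m v = (v^t* *m A *m v)^t*.
    by rewrite !adjmx_mul trmxCK mulmxA.
  rewrite [(_ ^t*) 0 0]mxE [_^T 0 0]mxE.
  by rewrite (CrealP (ger0_real (Apsd v))) subrr.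
have [u BS] := normalmx_rank1_sum B_normal.
apply/esym/eqP; rewrite -subr_eq0 -/B BS big1 // => k _.
by rewrite B0 scale0r.
Qed.

Lemma psdmx_rank1_sum (n : nat) (A : 'M[C]_n) : psdmx A ->
  exists (c : 'I_n -> C) (u : 'I_n -> 'cV[C]_n),
    (forall k, 0 <= c k) /\ A = \sum_k c k *: (u k *m (u k)^t*).
Proof.
move=> Apsd.
have A_normal : A \is normalmx by apply/normalmxP; rewrite psdmx_hermitian.
have [u AS] := normalmx_rank1_sum A_normal.
by exists (fun k => ((u k)^t* *m A *m u k) 0 0), u; split.
Qed.

Lemma positive_map_rank1 (m n : nat) (f : {linear 'M[C]_m -> 'M[C]_n}) :
  (forall v : 'cV_m, psdmx (f (v *m v^t*))) -> positive_map f.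
Proof.
move=> f_psd A /psdmx_rank1_sum[c [u [c_ge0 ->]]] w.
rewrite linear_sum mulmx_sumr mulmx_suml summxE; apply: sumr_ge0 => k _.
by rewrite linearZ -scalemxAr -scalemxAl mxE mulr_ge0 // f_psd.
Qed.

Lemma psdmx_rank1 (n : nat) (v : 'cV[C]_n) : psdmx (v *m v^t*).
Proof.
move=> w; have -> : w^t* *m (v *m v^t*) *m w = (v^t* *m w)^t* *m (v^t* *m w).
  by rewrite adjmx_mul trmxCK !mulmxA.
by rewrite mxE big_ord1 !mxE mulrC mul_conjC_ge0.
Qed.

(** * The maps Ad_M, with M possibly rectangular *)

Definition adconj (m n : nat) (M : 'M[C]_(n, m)) : 'Hom('M[C]_m, 'M[C]_n) :=
  linfun (mulmxr (M^t*) \o mulmx M).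

Lemma adconjE (m n : nat) (M : 'M[C]_(n, m)) (A : 'M[C]_m) :
  adconj M A = M *m A *m M^t*.
Proof. by rewrite lfunE. Qed.

Lemma adconj1 (n : nat) : adconj 1%:M = (\1 : 'End('M[C]_n))%VF.
Proof.
apply/lfunP => A.
by rewrite adconjE id_lfunE trmx1 map_mx1 mul1mx mulmx1.
Qed.

Lemma positive_adconj (m n : nat) (M : 'M[C]_(n, m)) : positive_map (adconj M).
Proof.
move=> A Apsd v; rewrite adconjE.
have -> : v^t* *m (M *m A *m M^t*) *m v = (M^t* *m v)^t* *m A *m (M^t* *m v).
  by rewrite adjmx_mul trmxCK !mulmxA.
exact: Apsd.
Qed.

(** Tensoring Ad_M with the identity gives Ad of 1 (x) M, which is again positive. *)
Lemma completely_positive_adconj (n : nat) (M : 'M[C]_n) :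
  completely_positive (adconj M).
Proof.
move=> k A Apsd.
suff <- : adconj (1%:M *t M) A = tensmap (\1 : 'End('M[C]_k))%VF (adconj M) A.
  exact: positive_adconj.
apply: tensmap_unique => a b.
rewrite !adconjE id_lfunE trmx_tens map_mxT trmx1 map_mx1.
by rewrite !tensmx_mul mul1mx mulmx1.
Qed.

(** * Quadratic forms of tensor product maps *)

(* The matrix V with v = sum V_ik e_i (x) e_k. *)
Definition unvec (m n : nat) (v : 'cV[C]_(m * n)) : 'M[C]_(m, n) :=
  \matrix_(i, k) v (mxtens_index (i, k)) 0.

(** With V = [unvec v] one has v = (V (x) 1) Omega, hence v v^* = sum_kl Ad_V(e_kl) (x) e_kl, to
    which psi (x) phi is applied termwise. *)
Lemma tensmap_rank1 (m n : nat) (psi : 'End('M[C]_m)) (phi : 'End('M[C]_n))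
    (v : 'cV[C]_(m * n)) :
  tensmap psi phi (v *m v^t*) =
  \sum_k \sum_l psi (adconj (unvec v) (delta_mx k l)) *t phi (delta_mx k l).
Proof.
have ad_delta k l : adconj (unvec v) (delta_mx k l) =
    \sum_i \sum_j (unvec v i k * (unvec v j l)^*) *: delta_mx i j.
  rewrite [LHS]matrix_sum_delta; apply: eq_bigr => i _; apply: eq_bigr => j _.
  congr (_ *: _); rewrite adconjE -(mul_delta_mx (0 : 'I_1)) mulmxA -mulmxA.
  by rewrite -colE -rowE mxE big_ord1 !mxE.
rewrite /tensmap.
under eq_bigr => i _ do rewrite exchange_big.
under eq_bigr => i _ do under eq_bigr => k _ do rewrite exchange_big.
rewrite exchange_big; apply: eq_bigr => k _.
rewrite exchange_big; apply: eq_bigr => l _ /=.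
apply/matrixP => x y; case: (mxtens_indexP x) => x1 x2.
case: (mxtens_indexP y) => y1 y2.
rewrite tensmxE ad_delta linear_sum !summxE mulr_suml; apply: eq_bigr => i _.
rewrite linear_sum !summxE mulr_suml; apply: eq_bigr => j _.
by rewrite linearZ /= mxE tensmxE !mxE big_ord1 !mxE mulrA.
Qed.

Lemma tens_quadratic (m n : nat) (A : 'M[C]_m) (B : 'M[C]_n)
    (w : 'cV[C]_(m * n)) :
  (w^t* *m (A *t B) *m w) 0 0 = \tr (B *m adconj (unvec w)^T A^T).
Proof.
(* Both sides are the same fourfold sum of entries; the second [transitivity] only reorders it. *)
transitivity (\sum_d \sum_l \sum_c \sum_k
    (unvec w c k)^* * (A c d * B k l) * unvec w d l).
  rewrite mxE sum_mxtens_index; apply: eq_bigr => d _; apply: eq_bigr => l _.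
  rewrite [unvec w d l]mxE mxE mulr_suml sum_mxtens_index; apply: eq_bigr => c _.
  by apply: eq_bigr => k _; rewrite tensmxE !mxE.
transitivity (\sum_k \sum_l \sum_c \sum_d
    (unvec w c k)^* * (A c d * B k l) * unvec w d l).
  under eq_bigr => d _ do under eq_bigr => l _ do rewrite exchange_big.
  under eq_bigr => d _ do rewrite exchange_big.
  rewrite exchange_big; apply: eq_bigr => k _ /=.
  rewrite exchange_big; apply: eq_bigr => l _ /=.
  exact: exchange_big.
rewrite adconjE /mxtrace; apply: eq_bigr => k _.
rewrite mxE; apply: eq_bigr => l _.
rewrite mxE mulr_sumr; apply: eq_bigr => c _.
rewrite [(_ *m _^T) _ _]mxE mulr_suml mulr_sumr; apply: eq_bigr => d _.
rewrite !mxE; ring.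
Qed.

(** * The trace pairing of Choi matrices *)

Lemma mxtrace_choi (n : nat) (phi psi : 'End('M[C]_n)) :
  \tr (choi phi *m choi psi) =
  \sum_i \sum_j \tr (phi (delta_mx i j) *m psi (delta_mx j i)).
Proof.
rewrite /choi mulmx_suml raddf_sum; apply: eq_bigr => i _.
rewrite mulmx_suml raddf_sum; apply: eq_bigr => j _ /=.
(* Tr (e_ij e_kl) vanishes unless k = j and l = i. *)
rewrite mulmx_sumr raddf_sum (bigD1 j) //= [X in _ + X]big1 => [|k kj]; last first.
  rewrite mulmx_sumr raddf_sum big1 // => l _ /=.
  by rewrite tensmx_mul mul_delta_mx_0 1?eq_sym // tens0mx mxtrace0.
rewrite addr0 mulmx_sumr raddf_sum (bigD1 i) //= big1 => [|l li].
  by rewrite addr0 tensmx_mul mul_delta_mx mxtrace_tens mxtrace_delta eqxx mul1r.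
by rewrite tensmx_mul mul_delta_mx mxtrace_tens mxtrace_delta eq_sym (negbTE li) mul0r.
Qed.

(** Tr (C_phi C_psi) is the trace of phi^* psi as an operator on the space B(H), so this is
    cyclicity of that trace, checked here in coordinates. *)
Lemma mxtrace_choi_comp (n : nat) (phi psi chi : 'End('M[C]_n)) :
  \tr (choi (phi \o psi)%VF *m choi chi) =
  \tr (choi phi *m choi (chi \o adjmap psi)%VF).
Proof.
rewrite !mxtrace_choi.
have adjE a b k l : adjmap psi (delta_mx l k) b a = psi (delta_mx a b) k l.
  rewrite lfunE mxE -(mul_delta_mx (0 : 'I_1) l k) mulmxA mxtrace_mulC mulmxA.
  by rewrite -rowE -colE trace_mx11 !mxE.
transitivity (\sum_a \sum_b \sum_k \sum_l
    psi (delta_mx a b) k l * \tr (phi (delta_mx k l) *m chi (delta_mx b a))).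
  apply: eq_bigr => a _; apply: eq_bigr => b _.
  rewrite comp_lfunE {1}(matrix_sum_delta (psi _)) linear_sum mulmx_suml raddf_sum.
  apply: eq_bigr => k _; rewrite linear_sum mulmx_suml raddf_sum.
  by apply: eq_bigr => l _; rewrite linearZ -scalemxAl /= mxtraceZ.
under eq_bigr => a _ do rewrite exchange_big.
under eq_bigr => a _ do under eq_bigr => k _ do rewrite exchange_big.
rewrite exchange_big; apply: eq_bigr => k _.
rewrite exchange_big; apply: eq_bigr => l _ /=.
rewrite exchange_big comp_lfunE (matrix_sum_delta (adjmap psi _)) linear_sum.
rewrite mulmx_sumr raddf_sum; apply: eq_bigr => b _.
rewrite linear_sum mulmx_sumr raddf_sum; apply: eq_bigr => a _.
by rewrite adjE linearZ -scalemxAr /= mxtraceZ.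
Qed.

Lemma tensmap_quadratic (m n : nat) (psi : 'End('M[C]_m)) (phi : 'End('M[C]_n))
    (v w : 'cV[C]_(m * n)) :
  (w^t* *m tensmap psi phi (v *m v^t*) *m w) 0 0 =
  \sum_k \sum_l \tr (phi (delta_mx k l) *m
    adconj (unvec w)^T (psi (adconj (unvec v) (delta_mx k l)))^T).
Proof.
rewrite tensmap_rank1 mulmx_sumr mulmx_suml summxE; apply: eq_bigr => k _.
rewrite mulmx_sumr mulmx_suml summxE; apply: eq_bigr => l _.
exact: tens_quadratic.
Qed.

Lemma trmx_adconj_delta (m n : nat) (M : 'M[C]_(n, m)) (k l : 'I_m) :
  (adconj M (delta_mx k l))^T = adconj (M^t*)^T (delta_mx l k).
Proof.
rewrite !adconjE !trmx_mul trmx_delta mulmxA; congr (_ *m _).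
by rewrite trmxK map_mxCK.
Qed.

(** The transpose from [tens_quadratic] on the output of psi and the one from [trmx_adconj_delta] on
    its input combine into psi^t. *)
Lemma tensmap_quadratic_choi (n : nat) (psi phi : 'End('M[C]_n))
    (v w : 'cV[C]_(n * n)) :
  (w^t* *m tensmap psi phi (v *m v^t*) *m w) 0 0 =
  \tr (choi phi *m
    choi (adconj (unvec w)^T \o trmap psi \o adconj ((unvec v)^t*)^T)%VF).
Proof.
rewrite tensmap_quadratic mxtrace_choi; apply: eq_bigr => k _.
apply: eq_bigr => l _; congr (\tr (_ *m _)).
by rewrite 2!comp_lfunE trmapE -trmx_adconj_delta trmxK.
Qed.

(** For psi the identity, the two rectangular conjugations merge into one Ad with an n by n matrix.
    Thus every ancilla dimension m is tested by completely positive maps on B(H) itself. *)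
Lemma tensmap1_quadratic_choi (m n : nat) (phi : 'End('M[C]_n))
    (v w : 'cV[C]_(m * n)) :
  (w^t* *m tensmap (\1 : 'End('M[C]_m))%VF phi (v *m v^t*) *m w) 0 0 =
  \tr (choi phi *m choi (adconj ((unvec w)^T *m ((unvec v)^t*)^T))).
Proof.
rewrite tensmap_quadratic mxtrace_choi; apply: eq_bigr => k _.
apply: eq_bigr => l _; congr (\tr (_ *m _)).
by rewrite id_lfunE trmx_adconj_delta !adconjE adjmx_mul !mulmxA.
Qed.

(** The vector Omega, whose coefficient matrix is the identity. *)
Definition vec1 (n : nat) : 'cV[C]_(n * n) :=
  \col_x ((mxtens_unindex x).1 == (mxtens_unindex x).2)%:R.

Lemma unvec_vec1 (n : nat) : unvec (vec1 n) = 1%:M.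
Proof. by apply/matrixP => i j; rewrite !mxE mxtens_indexK. Qed.

Lemma pmxE (n : nat) : pmx C n = vec1 n *m (vec1 n)^t*.
Proof.
apply/matrixP => x y; case: (mxtens_indexP x) => x1 x2.
case: (mxtens_indexP y) => y1 y2.
rewrite !mxE big_ord1 !mxE !mxtens_indexK conjC_nat /pmx summxE.
rewrite (bigD1 x1) //= summxE (bigD1 y1) //= tensmxE !mxE !eqxx mul1r.
rewrite big1 ?addr0 => [|j nj]; last first.
  by rewrite tensmxE !mxE (eq_sym y1) (negbTE nj) andbF mul0r.
rewrite big1 ?addr0 => [|i ni]; last first.
  rewrite summxE big1 // => j _.
  by rewrite tensmxE !mxE (eq_sym x1) (negbTE ni) mul0r.
by rewrite -natrM mulnb (eq_sym x2) (eq_sym y2).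
Qed.

End Positivity.

Theorem theorem2 (R : realType) (n : nat)
    (phi : 'End('M[R[i]%C]_n)) (K : set 'End('M[R[i]%C]_n))
    (phi_pos : positive_map phi)
    (K_mapping_cone : mapping_cone K)
    (K_symmetric : symmetric_cone K) :
  [<-> dual_cone K phi;
       forall psi, K psi -> completely_positive (phi \o psi)%VF;
       forall psi, K psi -> positive_map (tensmap psi phi);
       forall psi, K psi -> psdmx (tensmap psi phi (pmx R[i]%C n))].
Proof.
have Kadj psi : K psi -> K (adjmap psi) by move=> Kpsi; apply/(K_symmetric psi).1.
have Ktr psi : K psi -> K (trmap psi).
  by move=> Kpsi; apply/(K_symmetric psi).2/Kadj.
have trmapK (psi : 'End('M[R[i]%C]_n)) : trmap (trmap psi) = psi.
  by apply/lfunP => A; rewrite !trmapE !trmxK.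
tfae.
- move=> [_ phi_dual] psi Kpsi k; apply: positive_map_rank1 => v w.
  (* The adjoint moves psi to the other side: the form becomes Tr (C_phi C_chi) with chi = Ad
     psi^*. *)
  rewrite tensmap1_quadratic_choi mxtrace_choi_comp; apply: phi_dual.
  by apply: mcone_compl (Kadj _ Kpsi) => //; apply: completely_positive_adconj.
- move=> phi_cp psi Kpsi; apply: positive_map_rank1 => v w.
  rewrite tensmap_quadratic_choi; set chi := (_ \o _)%VF.
  have Kchi : K chi.
    apply: mcone_compr => //; last exact: completely_positive_adconj.
    by apply: mcone_compl (Ktr _ Kpsi) => //; apply: completely_positive_adconj.
  have := phi_cp _ (Kadj _ Kchi) n _ (psdmx_rank1 (vec1 _ n)) (vec1 _ n).
  rewrite tensmap1_quadratic_choi unvec_vec1 trmx1 map_mx1 trmx1 mul1mx adconj1.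
  rewrite mxtrace_choi_comp comp_lfun1l.
  suff -> : adjmap (adjmap chi) = chi by [].
  apply/esym/adjmap_unique => a b.
  by rewrite mxtrace_mulC -adjmapP mxtrace_mulC.
- by move=> phi_pos2 psi Kpsi; apply: phi_pos2 => //; rewrite pmxE; apply: psdmx_rank1.
(* The hypothesis is applied to psi^t and tested on Omega: both Ad's become the identity, and the
   second transposition restores psi. *)
- move=> phi_psd; split=> // psi /Ktr/phi_psd/(_ (vec1 _ n)).
  rewrite pmxE tensmap_quadratic_choi unvec_vec1 trmx1 map_mx1 trmx1 adconj1.
  by rewrite comp_lfun1l comp_lfun1r trmapK.
Qed.
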